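(* Let $d\ge2$ and $n\ge1$ be integers and let $\alpha>0$ be bounded away from $1/2$ by some constant, i.e. $0<\alpha<1/2$. Fix an orthonormal basis $(|\psi_k\rangle)_{k=1}^d$ of $\mathbb C^d$, and for a pure state $\rho=|\psi\rangle\langle\psi|$ with $|\psi\rangle=\sum_{k=1}^d\gamma_k|\psi_k\rangle$ set $p(\rho)=[|\gamma_1|^2,\dots,|\gamma_d|^2]^\top$. Then $$\inf_{(M,\hat p)}\ \sup_{\rho\in\mathcal S_{pure}(\mathbb C^d)}\mathbb E_\rho\big[\|\hat p-p(\rho)\|_2^2\big]\ \ge\ \min\Big\{\frac1{8d},\ \frac{(1-2\alpha)^4d}{1024\,n\,\alpha^2}\Big\},$$ where the infimum is over all locally-$\alpha$-gentle measurements $M$ of $\rho^{\otimes n}$ and subsequent estimators $\hat p$.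
   Context: $\mathcal S(\mathbb C^d)$ is the set of density matrices on $\mathbb C^d$, $\mathcal S_{pure}(\mathbb C^d)$ the rank-one ones. A measurement on $\mathbb C^d$ is a countable family $M=(M_\omega)_{\omega\in\Omega}$ of matrices in $\mathbb C^{d\times d}$ with $\sum_\omega M_\omega^*M_\omega=\mathbb 1$; put $E_\omega=M_\omega^*M_\omega$. Measuring $\rho$ yields a random outcome $R^M$ with $\mathbb P_\rho(R^M=\omega)=\operatorname{Tr}[\rho E_\omega]$ and, if this is positive, the post-measurement state $\rho_{M\to\omega}=M_\omega\rho M_\omega^*/\operatorname{Tr}[\rho E_\omega]$. With $\|A\|_{Tr}=\frac12\operatorname{Tr}|A|$, $M$ is $\alpha$-gentle on $\mathcal S(\mathbb C^d)$ if $\|\rho-\rho_{M\to\omega}\|_{Tr}\le\alpha$ for all $\rho\in\mathcal S(\mathbb C^d)$ and all outcomes $\omega$ (of positive probability). A locally-$\alpha$-gentle measurement on $n$ copies is a product measurement $M_1\otimes\dots\otimes M_n$, applied to $\rho^{\otimes n}$, in which each $M_i$ is $\alpha$-gentle on $\mathcal S(\mathbb C^d)$. An estimator $\hat p$ is an $\mathbb R^d$-valued function of the outcome. *)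

(* Defs.v *)
From mathcomp Require Import all_boot all_order all_algebra spectral finmap.
From mathcomp Require Import complex.
From mathcomp Require Import all_classical all_reals all_analysis.
From mathcomp Require Import summability.
Set Implicit Arguments.
Unset Strict Implicit.
Unset Printing Implicit Defensive.
Import Order.TTheory GRing.Theory Num.Theory.
Import numFieldNormedType.Exports.

Local Open Scope classical_set_scope.
Local Open Scope ring_scope.
Local Open Scope sesquilinear_scope.

(* Unconditional convergence of a family of scalars: the net of its finite
   partial sums tends to [l].  It is stated over an abstract [K] because the
   library does not register a topology on [R[i]] itself; at [K := R[i]] the
   topology used is the one given by the modulus. *)
Definition has_sum (K : numFieldType) (I : choiceType) (x : I -> K) (l : K) :
    Prop :=
  (fun F : {fset I} => \sum_(i <- F) x i) @ totally --> l.

(* The order of [R[i]] makes [0 <= z] mean that [z] is real and nonnegative,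
   so that hermitian symmetry is implied. *)
Definition psdmx (R : realType) (d : nat) (A : 'M[R[i]]_d) : Prop :=
  forall v : 'cV[R[i]]_d, 0 <= (v^t* *m A *m v) 0 0.

Definition density_mx (R : realType) (d : nat) (rho : 'M[R[i]]_d) : Prop :=
  psdmx rho /\ \tr rho = 1.

Definition pure_state (R : realType) (d : nat) (rho : 'M[R[i]]_d) : Prop :=
  density_mx rho /\ \rank rho = 1%N.

Definition ketbra (R : realType) (d : nat) (v : 'cV[R[i]]_d) : 'M[R[i]]_d :=
  v *m v^t*.

Definition orthonormal_basis (R : realType) (d : nat)
    (psi : 'I_d -> 'cV[R[i]]_d) : Prop :=
  forall j k, (psi j)^t* *m psi k = (j == k)%:R%:M.

(* |A| = (A^* A)^(1/2), by diagonalizing A^* A = P^-1 diag(s) P, P unitary. *)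
Definition absmx (R : realType) (d : nat) (A : 'M[R[i]]_d) : 'M[R[i]]_d :=
  let H := A^t* *m A in
  invmx (spectralmx H) *m diag_mx (map_mx sqrtC (spectral_diag H))
    *m spectralmx H.

Definition trnorm (R : realType) (d : nat) (A : 'M[R[i]]_d) : R :=
  complex.Re (\tr (absmx A)) / 2.

Definition effect (R : realType) (W : Type) (d : nat) (M : W -> 'M[R[i]]_d)
    (w : W) : 'M[R[i]]_d :=
  (M w)^t* *m M w.

Definition measurement (R : realType) (W : countType) (d : nat)
    (M : W -> 'M[R[i]]_d) : Prop :=
  forall j k, has_sum (fun w => effect M w j k) ((1%:M : 'M[R[i]]_d) j k).

(* The trace is real whenever [rho] is positive semidefinite. *)
Definition outcome_prob (R : realType) (W : Type) (d : nat)
    (M : W -> 'M[R[i]]_d) (rho : 'M[R[i]]_d) (w : W) : R :=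
  complex.Re (\tr (rho *m effect M w)).

Definition post_state (R : realType) (W : Type) (d : nat)
    (M : W -> 'M[R[i]]_d) (rho : 'M[R[i]]_d) (w : W) : 'M[R[i]]_d :=
  (\tr (rho *m effect M w))^-1 *: (M w *m rho *m (M w)^t*).

Definition gentle (R : realType) (W : Type) (d : nat) (alpha : R)
    (M : W -> 'M[R[i]]_d) : Prop :=
  forall rho, density_mx rho -> forall w, 0 < outcome_prob M rho w ->
    trnorm (rho - post_state M rho w) <= alpha.

(* A_1 (x) ... (x) A_n on (C^d)^(x)n.  The product basis of this space is
   indexed by the functions 'I_n -> 'I_d, of which there are d ^ n, listed in
   the order of [enum]. *)
Definition tensmxn (R : realType) (n d : nat) (A : 'I_n -> 'M[R[i]]_d) :
    'M[R[i]]_#|{ffun 'I_n -> 'I_d}| :=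
  \matrix_(a, b)
    \prod_(i < n) A i ((enum_val a : {ffun 'I_n -> 'I_d}) i)
                      ((enum_val b : {ffun 'I_n -> 'I_d}) i).

Definition tensor_measurement (R : realType) (n d : nat)
    (W : 'I_n -> countType) (M : forall i, W i -> 'M[R[i]]_d)
    (w : {dffun forall i : 'I_n, W i}) : 'M[R[i]]_#|{ffun 'I_n -> 'I_d}| :=
  tensmxn (fun i => M i (w i)).

Definition locally_gentle (R : realType) (n d : nat) (alpha : R)
    (W : 'I_n -> countType) (M : forall i, W i -> 'M[R[i]]_d) : Prop :=
  forall i, measurement (M i) /\ gentle alpha (M i).

Definition sqnorm2 (R : realType) (d : nat) (v : 'cV[R]_d) : R :=
  \sum_(k < d) v k 0 ^+ 2.

(* E_rho[||phat - p||_2^2], possibly +oo, for the outcome of M measured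
   on rho. *)
Definition expected_loss (R : realType) (W : countType) (D d : nat)
    (M : W -> 'M[R[i]]_D) (phat : W -> 'cV[R]_d) (rho : 'M[R[i]]_D)
    (p : 'cV[R]_d) : \bar R :=
  \esum_(w in [set: W]) (outcome_prob M rho w * sqnorm2 (phat w - p))%:E.

(* sup over pure rho of E_rho[||phat - p(rho)||_2^2].  The amplitudes [gamma]
   of [rho] in an orthonormal basis [psi] are unique up to a global
   phase, on which p(rho) does not depend. *)
Definition worst_risk (R : realType) (n d : nat) (psi : 'I_d -> 'cV[R[i]]_d)
    (W : 'I_n -> countType) (M : forall i, W i -> 'M[R[i]]_d)
    (phat : {dffun forall i : 'I_n, W i} -> 'cV[R]_d) : \bar R :=
  ereal_sup [set r | exists (rho : 'M[R[i]]_d) (gamma : 'I_d -> R[i]),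
    [/\ pure_state rho,
        rho = ketbra (\sum_(k < d) gamma k *: psi k) &
        r = expected_loss (tensor_measurement M) phat
              (tensmxn (fun _ : 'I_n => rho))
              (\col_(k < d) (complex.Re `|gamma k| ^+ 2))]].

(* Main.v *)
Require Import Defs.
From mathcomp Require Import all_boot all_order all_algebra.
From mathcomp Require Import complex.
From mathcomp Require Import all_classical all_reals all_analysis.
From mathcomp Require Import spectral finmap ring lra.
From mathcomp Require Import summability.
Set Implicit Arguments.
Unset Strict Implicit.
Unset Printing Implicit Defensive.
Import Order.TTheory GRing.Theory Num.Theory.
Import numFieldNormedType.Exports.
Local Open Scope classical_set_scope.
Local Open Scope ring_scope.
Local Open Scope sesquilinear_scope.

(** Why the bound holds.

    If a measurement is [alpha]-gentle, each of its effects is close to a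
    multiple of the identity.  Indeed, measure the uniform mixture of two
    eigenvectors of the effect, with eigenvalues [l_1 >= l_2]: the
    post-measurement state has eigenvalues [l_k / (l_1 + l_2)] instead of
    [1/2], so that [(l_1 - l_2) / (l_1 + l_2) <= 2 alpha]
    ([gentle_eigenvalue_gap]).  With [c] half the sum of the extreme
    eigenvalues, the effect is [c (1 + D)] where [D] has operator norm at most
    [2 alpha] ([gentle_effect_near_scalar]).  The scalar part does not
    distinguish states, hence each copy carries information of order
    [alpha ^ 2] only.

    The lower bound is then Assouad's.  The states have real amplitudes in the
    basis, arranged in [m] pairs, [m] being half the dimension: the amplitudes
    of the pair [j] are [a + b] and [a - b], in the order given by the bit
    [tau j].  Flipping the bit [j] moves the state along a vector [v_j], and
    the [v_j] are orthogonal with squared length [8 b ^ 2].  The outcome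
    probability changes by an inner product of [v_j] with [D psi], so by
    Bessel's inequality the squared changes sum over [j] to order
    [b ^ 2 alpha ^ 2], not [m] times that ([cube_form_variation]).  As the
    probabilities are at least [(1 - 2 alpha) c], this bounds the sum over [j]
    of the squared Hellinger distances of one copy ([hellinger_variation]).
    Affinities multiply over the [n] copies, so Assouad's argument
    ([assouad_product]) shows that no estimator recovers more than a fraction
    of the [m] bits while [n b ^ 2 alpha ^ 2] is small compared with [m].  Each
    undecided bit costs [(4 a b) ^ 2]; optimising [b] under the constraint
    [2 m (a ^ 2 + b ^ 2) = 1] gives both terms of the minimum
    ([rate_arithmetic]).

    The outcome sets are countable.  Since risks are nonnegative, it is enough
    to sum over a product of finite outcome sets, one for each copy, that
    carry almost all the mass under every state of the hypercube
    ([cube_state_statistics]). *)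

(** * The trace norm and unitary matrices *)

(** Cauchy-Schwarz against a unit vector, from
    [2 t |y_i b_i| <= t ^ 2 |y_i| ^ 2 + |b_i| ^ 2]. *)
Lemma unit_pairing_le (C : numClosedFieldType) (I : finType) (y b : I -> C)
    (t : C) :
  0 <= t -> \sum_i `|y i| ^+ 2 = 1 -> \sum_i `|b i| ^+ 2 = t ^+ 2 ->
  `|\sum_i y i * b i| <= t.
Proof.
move=> t0 hy hb; have [tz|tnz] := eqVneq t 0.
  rewrite tz in hb *; rewrite big1 ?normr0 // => i _.
  have b0 : \sum_i `|b i| ^+ 2 = 0 by rewrite hb expr0n.
  have sq0 k : true -> 0 <= `|b k| ^+ 2 by rewrite exprn_ge0.
  have /eqP := @psumr_eq0P _ _ _ _ sq0 b0 i isT.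
  by rewrite expf_eq0 /= normr_eq0 => /eqP->; rewrite mulr0.
have tp : 0 < t by rewrite lt_neqAle eq_sym tnz.
have t2 : 0 < 2 * t by rewrite mulr_gt0.
rewrite -(ler_pM2l t2).
apply: (@le_trans _ _ (\sum_i (t ^+ 2 * `|y i| ^+ 2 + `|b i| ^+ 2))).
  apply: le_trans (ler_wpM2l (ltW t2) (ler_norm_sum _ _ _)) _.
  rewrite mulr_sumr; apply: ler_sum => i _; rewrite normrM.
  rewrite -subr_ge0.
  have -> : t ^+ 2 * `|y i| ^+ 2 + `|b i| ^+ 2 - 2 * t * (`|y i| * `|b i|)
      = (t * `|y i| - `|b i|) ^+ 2 by ring.
  by rewrite real_exprn_even_ge0 // rpredB ?rpredM ?normr_real // gtr0_real.
rewrite big_split /= -mulr_sumr hy hb.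
suff -> : t ^+ 2 * 1 + t ^+ 2 = 2 * t * t by [].
by ring.
Qed.

Lemma gram_hermitian (C : numClosedFieldType) (m n : nat) (A : 'M[C]_(m, n)) :
  A^t* *m A \is hermsymmx.
Proof.
by apply/is_hermitianmxP; rewrite expr0 scale1r trmx_mul map_mxM trmxCK.
Qed.

Lemma gram_spectral (C : numClosedFieldType) (m n : nat) (A : 'M[C]_(m, n)) :
  let H := A^t* *m A in
  H = (spectralmx H)^t* *m diag_mx (spectral_diag H) *m spectralmx H.
Proof.
move=> H; rewrite -invmx_unitary ?spectral_unitarymx //.
by apply/orthomx_spectralP/hermitian_normalmx/gram_hermitian.
Qed.

Lemma unitaryC (C : numClosedFieldType) (n : nat) (P : 'M[C]_n) :
  P \is unitarymx -> P^t* *m P = 1%:M.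
Proof. by move=> /unitarymxP /mulmx1C. Qed.

Lemma trmxC_mul (C : numClosedFieldType) (m n p : nat) (A : 'M[C]_(m, n))
    (B : 'M[C]_(n, p)) : (A *m B)^t* = B^t* *m A^t*.
Proof. by rewrite trmx_mul map_mxM. Qed.

Lemma gram_diagE (C : numClosedFieldType) (m n : nat) (B : 'M[C]_(m, n)) i :
  (B^t* *m B) i i = \sum_k `|B k i| ^+ 2.
Proof. by rewrite mxE; apply: eq_bigr => k _; rewrite !mxE normCKC. Qed.

(** The easy half of the duality between the trace norm and the operator norm.
    With [P] diagonalising [A^* A], the columns of [A P^*] have the singular
    values of [A] as norms, and the trace pairs them with the rows of the
    unitary matrix [P X]. *)
Lemma trace_unitary_le (C : numClosedFieldType) (n : nat) (X A : 'M[C]_n) :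
  X \is unitarymx ->
  `|\tr (X *m A)| <= \sum_i sqrtC (spectral_diag (A^t* *m A) 0 i).
Proof.
move=> hX; set H := A^t* *m A; set P := spectralmx H.
have hP : P \is unitarymx := spectral_unitarymx H.
set B := A *m P^t*.
have hB : B^t* *m B = diag_mx (spectral_diag H).
  have eH : H = P^t* *m diag_mx (spectral_diag H) *m P := gram_spectral A.
  rewrite /B trmxC_mul trmxCK !mulmxA -(mulmxA P) -/H {1}eH.
  by rewrite !mulmxA (unitarymxP hP) mul1mx -mulmxA (unitarymxP hP) mulmx1.
set Y := P *m X.
have hY : Y \is unitarymx by apply: mul_unitarymx.
have -> : \tr (X *m A) = \tr (Y *m B).
  by rewrite /Y /B mulmxA [RHS]mxtrace_mulC !mulmxA unitaryC // mul1mx.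
rewrite /mxtrace; apply: le_trans (ler_norm_sum _ _ _) _.
apply: ler_sum => i _; rewrite mxE.
have ei : spectral_diag H 0 i = \sum_k `|B k i| ^+ 2.
  by rewrite -gram_diagE hB mxE eqxx mulr1n.
apply: unit_pairing_le.
- by rewrite sqrtC_ge0 ei sumr_ge0 // => k _; rewrite exprn_ge0.
- have /matrixP/(_ i i) := unitarymxP hY; rewrite !mxE eqxx mulr1n => <-.
  by apply: eq_bigr => k _; rewrite !mxE normCK.
- by rewrite sqrtCK ei.
Qed.

Lemma trace_unitary_le_trnorm (R : realType) (d : nat) (X A : 'M[R[i]]_d) :
  X \is unitarymx -> `|\tr (X *m A)| <= (2 * trnorm A)%:C%C.
Proof.
move=> hX; rewrite /trnorm mulrC divfK //.
have -> : \tr (absmx A) = \sum_i sqrtC (spectral_diag (A^t* *m A) 0 i).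
  rewrite /absmx mxtrace_mulC mulmxA mulmxV ?spectral_unit // mul1mx.
  by rewrite mxtrace_diag; apply: eq_bigr => i _; rewrite mxE.
apply: le_trans (trace_unitary_le A hX) _.
have hreal := le_trans (normr_ge0 _) (trace_unitary_le A hX).
by rewrite RRe_real ?ger0_real.
Qed.

(** * Effects of gentle measurements *)

Lemma mxtrace_delta_mul (C : comNzRingType) (n : nat) (i : 'I_n) (A : 'M[C]_n) :
  \tr (delta_mx i i *m A) = A i i.
Proof.
rewrite -(mul_delta_mx (0 : 'I_1)) -mulmxA mxtrace_mulC -rowE -colE.
by rewrite trace_mx11 !mxE.
Qed.

(** The eigenvectors are the conjugated rows of [P], as in the spectral
    decomposition [P^* diag P]. *)
Definition eigenpair_mix (C : numClosedFieldType) (n : nat) (P : 'M[C]_n)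
    (i j : 'I_n) : 'M[C]_n :=
  2^-1 *: (P^t* *m (delta_mx i i + delta_mx j j) *m P).

Lemma tr_eigenpair_mix_mul (C : numClosedFieldType) (n : nat) (P A : 'M[C]_n)
    i j :
  \tr (eigenpair_mix P i j *m A)
    = 2^-1 * ((P *m A *m P^t*) i i + (P *m A *m P^t*) j j).
Proof.
rewrite -scalemxAl mxtraceZ -!mulmxA mxtrace_mulC !mulmxA.
rewrite !mulmxDl -!mulmxA mxtraceD -!mxtrace_delta_mul.
by rewrite !mulmxA.
Qed.

Lemma density_eigenpair_mix (R : realType) (d : nat) (P : 'M[R[i]]_d) i j :
  P \is unitarymx -> density_mx (eigenpair_mix P i j).
Proof.
move=> hP; split; last first.
  rewrite -[eigenpair_mix _ _ _]mulmx1 tr_eigenpair_mix_mul mulmx1.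
  by rewrite (unitarymxP hP) !mxE !eqxx /=; field.
move=> v; rewrite -trace_mx11 mxtrace_mulC mulmxA mxtrace_mulC.
rewrite tr_eigenpair_mix_mul.
have -> : P *m (v *m v^t*) *m P^t* = (P *m v) *m (P *m v)^t*.
  by rewrite trmxC_mul !mulmxA.
have h k : 0 <= ((P *m v) *m (P *m v)^t*) k k.
  rewrite mxE; apply: sumr_ge0 => l _; rewrite !mxE -normCK exprn_ge0 //.
by rewrite mulr_ge0 ?invr_ge0 // addr_ge0.
Qed.

(** Gentleness is tested on the uniform mixture of two eigenvectors of the
    effect.  Their images [y_i], [y_j] under the Kraus operator are orthogonal,
    with squared norms [l_i], [l_j], so the post-measurement state puts weight
    [l_i / (l_i + l_j)] on the line of [y_i]; by Bessel's inequality the mixture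
    puts weight at most [1/2] there.  The reflection that fixes [y_i] turns
    this difference of weights into a lower bound on the trace distance. *)
Lemma gentle_eigenvalue_gap (R : realType) (W : Type) (d : nat) (alpha : R)
    (M : W -> 'M[R[i]]_d) (w : W) (P : 'M[R[i]]_d) (l : 'rV[R[i]]_d)
    (i j : 'I_d) :
  gentle alpha M -> P \is unitarymx -> P *m effect M w *m P^t* = diag_mx l ->
  i != j -> 0 < l 0 i ->
  l 0 i - l 0 j <= (2 * alpha)%:C%C * (l 0 i + l 0 j).
Proof.
move=> hgM hP hL nij li0; have hg := fun rho hrho => hgM rho hrho w.
rewrite /outcome_prob /post_state /effect in hg hL.
move: (M w) hg hL => K hg hL.
have [B defB] : exists B, B = K *m P^t* by exists (K *m P^t*).
have hB : B^t* *m B = diag_mx l by rewrite defB trmxC_mul trmxCK -hL !mulmxA.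
have lE k : l 0 k = \sum_m `|B m k| ^+ 2.
  by rewrite -gram_diagE hB mxE eqxx mulr1n.
have lj0 : 0 <= l 0 j by rewrite lE sumr_ge0 // => k _; rewrite exprn_ge0.
have lij : 0 < l 0 i + l 0 j by rewrite ltr_wpDr.
set e := delta_mx i i + delta_mx j j : 'M[R[i]]_d.
set rho := eigenpair_mix P i j.
have hrho : density_mx rho by apply: density_eigenpair_mix.
have htr : \tr (rho *m (K^t* *m K)) = 2^-1 * (l 0 i + l 0 j).
  by rewrite tr_eigenpair_mix_mul hL !mxE !eqxx !mulr1n.
have htr0 : 0 < \tr (rho *m (K^t* *m K)) by rewrite htr mulr_gt0 ?invr_gt0.
have hpost : (\tr (rho *m (K^t* *m K)))^-1 *: (K *m rho *m K^t*)
    = (l 0 i + l 0 j)^-1 *: (B *m e *m B^t*).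
  rewrite htr /rho /eigenpair_mix -scalemxAr -scalemxAl scalerA.
  rewrite defB trmxC_mul trmxCK !mulmxA; congr (_ *: _).
  by field; rewrite (gt_eqF lij).
have hre : 0 < complex.Re (\tr (rho *m (K^t* *m K))).
  by move: htr0; rewrite ltcE => /andP[].
have := hg rho hrho hre; rewrite hpost => hal.
set post := _ *: (B *m e *m B^t*) in hal.
(* [G / l_i] is the projection onto the line of the image of the first
   eigenvector, and [X] below the reflection that fixes this line. *)
set G := B *m delta_mx i i *m B^t*.
have hdl : delta_mx i i *m diag_mx l *m delta_mx i i
    = l 0 i *: delta_mx i i :> 'M[R[i]]_d.
  apply/matrixP => a b; rewrite mul_mx_diag !mxE.
  rewrite (bigD1 i) //= big1 ?addr0; last first.
    by move=> k nk; rewrite !mxE (negPf nk) andbF mul0r mul0r.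
  rewrite !mxE !eqxx !andbT /=.
  by case: (a == i); case: (b == i); rewrite /= ?mul1r ?mulr1 ?mul0r ?mulr0.
have GG : G *m G = l 0 i *: G.
  transitivity (B *m (delta_mx i i *m diag_mx l *m delta_mx i i) *m B^t*).
    by rewrite /G !mulmxA -(mulmxA _ (B^t*) B) hB.
  by rewrite hdl -scalemxAr -scalemxAl.
have Gh : G^t* = G.
  by rewrite /G !trmxC_mul trmxCK trmx_delta map_delta_mx mulmxA.
set X := (2 / l 0 i) *: G - 1%:M.
have li_neq0 : l 0 i != 0 by rewrite gt_eqF.
have hX : X \is unitarymx.
  have c0 : (2 / l 0 i)^* = 2 / l 0 i :> R[i].
    by apply: conj_Creal; rewrite rpred_div ?gtr0_real ?ltr0n.
  have Xh : X^t* = X.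
    rewrite /X linearB linearZ /= map_mxB map_mxZ Gh trmx1 map_mx1.
    by congr (_ *: _ - _); exact: c0.
  apply/unitarymxP; rewrite Xh /X mulmxBl mulmxBr mul1mx mulmx1.
  rewrite -scalemxAl -scalemxAr GG !scalerA opprB.
  suff -> : 2 / l 0 i * (2 / l 0 i) * l 0 i = 2 / l 0 i + 2 / l 0 i.
    by rewrite scalerDl addrK addrC subrK.
  by field.
have hde : delta_mx i i *m diag_mx l *m e *m diag_mx l
    = l 0 i ^+ 2 *: delta_mx i i :> 'M[R[i]]_d.
  rewrite /e mulmxDr hdl.
  have -> : delta_mx i i *m diag_mx l *m delta_mx j j = 0 :> 'M[R[i]]_d.
    apply/matrixP => a b; rewrite mul_mx_diag !mxE big1 // => k _.
    rewrite !mxE; case: (eqVneq k i) => [->|_]; last by rewrite andbF !mul0r.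
    by rewrite (negPf nij) /= mulr0.
  rewrite addr0 -scalemxAl; apply/matrixP => a b; rewrite mul_mx_diag !mxE.
  case: (eqVneq b i) => [->|_]; rewrite ?andbF ?mul0r ?mulr0 ?eqxx ?andbT //.
  by rewrite expr2 mulrA mulrAC.
have trGpost : \tr (G *m post) = l 0 i ^+ 2 / (l 0 i + l 0 j).
  rewrite /post -scalemxAr mxtraceZ mulrC; congr (_ / _).
  rewrite /G !mulmxA -(mulmxA _ (B^t*) B) hB mxtrace_mulC !mulmxA hB.
  rewrite -!mulmxA mxtrace_mulC !mulmxA hde mxtraceZ.
  by rewrite -[delta_mx i i]mulmx1 mxtrace_delta_mul mxE eqxx mulr1.
have trpost : \tr post = 1.
  rewrite /post mxtraceZ mxtrace_mulC mulmxA hB mxtrace_mulC mulmxDl.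
  rewrite mxtraceD !mxtrace_delta_mul !mxE !eqxx !mulr1n mulVf //.
  by rewrite gt_eqF.
(* Bessel: the [i]-th column of [P B] has squared norm [l_i], and only two of
   its entries are read. *)
have trGrho : \tr (G *m rho) <= 2^-1 * l 0 i.
  rewrite mxtrace_mulC tr_eigenpair_mix_mul ler_pM2l ?invr_gt0 //.
  set Z := P *m B.
  have -> : P *m G *m P^t*
      = Z *m delta_mx i 0 *m (Z *m delta_mx i (0 : 'I_1))^t*.
    rewrite /G -(mul_delta_mx (0 : 'I_1)) !trmxC_mul trmx_delta map_delta_mx.
    by rewrite !mulmxA.
  rewrite -colE; have hZ k : (col i Z *m (col i Z)^t*) k k = `|Z k i| ^+ 2.
    by rewrite mxE big_ord1 !mxE normCK.
  have hn : l 0 i = \sum_k `|Z k i| ^+ 2.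
    rewrite -gram_diagE /Z trmxC_mul mulmxA -(mulmxA _ (P^t*)) unitaryC //.
    by rewrite mulmx1 hB mxE eqxx mulr1n.
  rewrite !hZ hn (bigD1 i) //= (bigD1 j) 1?eq_sym //= addrA lerDl.
  by apply: sumr_ge0 => k _; rewrite exprn_ge0.
have trrho : \tr rho = 1 by case: hrho.
have := trace_unitary_le_trnorm (rho - post) hX.
set T := 2 / l 0 i * (\tr (G *m rho) - l 0 i ^+ 2 / (l 0 i + l 0 j)).
have hT : \tr (X *m (rho - post)) = T.
  have trX (c : R[i]) (A S S' : 'M[R[i]]_d) : \tr ((c *: A - 1%:M) *m (S - S'))
      = c * (\tr (A *m S) - \tr (A *m S')) - (\tr S - \tr S').
    by rewrite mulmxBl mul1mx mulmxBr -!scalemxAl !raddfB /= !mxtraceZ; ring.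
  by rewrite trX trGpost trrho trpost subrr subr0.
rewrite hT => hup.
have sij : l 0 i + l 0 j != 0 by rewrite gt_eqF.
have lo : (l 0 i - l 0 j) / (l 0 i + l 0 j) <= - T.
  rewrite -subr_ge0.
  have -> : - T - (l 0 i - l 0 j) / (l 0 i + l 0 j)
     = 2 / l 0 i * (2^-1 * l 0 i - \tr (G *m rho)).
    by rewrite /T; field; rewrite sij li_neq0.
  by rewrite mulr_ge0 ?subr_ge0 // divr_ge0 ?ltW.
have lor : (l 0 i - l 0 j) / (l 0 i + l 0 j) \is Num.real.
  apply: realM; last by rewrite realV gtr0_real.
  by apply: realB; [exact: gtr0_real|exact: ger0_real].
have Tr : - T \is Num.real by rewrite -(ler_real lo).
rewrite -ler_pdivrMr //; apply: le_trans lo _.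
apply: le_trans (real_ler_norm Tr) _; rewrite normrN.
by apply: le_trans hup _; rewrite lecR ler_pM2l.
Qed.

(** The midpoint of the largest and the smallest value is such a [c]. *)
Lemma centered_spread (R : realType) (d : nat) (alpha : R) (l : 'I_d -> R) :
  (0 < d)%N -> 0 < alpha -> (forall k, 0 <= l k) ->
  (forall i j, i != j -> 0 < l i -> l i - l j <= 2 * alpha * (l i + l j)) ->
  exists2 c : R, 0 <= c & forall k, `|l k - c| <= 2 * alpha * c.
Proof.
case: d l => // d l _ a0 l0 hl.
have [i _ imax] := arg_maxP l (isT : xpredT (ord0 : 'I_d.+1)).
have [j _ jmin] := arg_minP l (isT : xpredT (ord0 : 'I_d.+1)).
have lj := l0 j; have li := l0 i; have lji : l j <= l i := imax j isT.
have gap : l i - l j <= 2 * alpha * (l i + l j).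
  have [->|nij] := eqVneq i j.
    by rewrite subrr mulr_ge0 ?addr_ge0 // mulr_ge0 // ltW.
  have [lp|] := ltP 0 (l i); first exact: hl.
  move=> li'; have -> : l i = 0 by lra.
  have -> : l j = 0 by lra.
  by rewrite subrr addr0 mulr0.
exists ((l i + l j) / 2); first by rewrite divr_ge0 ?addr_ge0.
move=> k; have hi : l k <= l i := imax k isT.
have hj : l j <= l k := jmin k isT.
rewrite ler_norml; apply/andP; split; lra.
Qed.

(** With [c] the midpoint of the spectrum of the effect, the relative
    spectral gap bounds the distance of the effect to [c 1] in operator norm. *)
Lemma gentle_effect_near_scalar (R : realType) (W : Type) (d : nat) (alpha : R)
    (M : W -> 'M[R[i]]_d) (w : W) :
  (0 < d)%N -> 0 < alpha -> gentle alpha M ->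
  exists2 c : R, 0 <= c & forall x : 'cV[R[i]]_d,
    ((1 - 2 * alpha) * c)%:C%C * (x^t* *m x) 0 0
       <= (x^t* *m effect M w *m x) 0 0
    /\ let y := effect M w *m x - c%:C%C *: x in
       (y^t* *m y) 0 0 <= ((2 * alpha * c) ^+ 2)%:C%C * (x^t* *m x) 0 0.
Proof.
move=> d0 a0 hg.
have := gram_spectral (M w); rewrite -/(effect M w); set E := effect M w => /=.
have := spectral_unitarymx E.
move: (spectralmx E) (spectral_diag E) => P l hP hE.
have hL : P *m E *m P^t* = diag_mx l.
  rewrite hE !mulmxA (unitarymxP hP) mul1mx.
  by rewrite -mulmxA (unitarymxP hP) mulmx1.
have l0 k : 0 <= l 0 k.
  have <- : ((M w *m P^t*)^t* *m (M w *m P^t*)) k k = l 0 k.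
    rewrite trmxC_mul trmxCK mulmxA -(mulmxA P) -/(effect M w) -/E hL.
    by rewrite mxE eqxx mulr1n.
  by rewrite gram_diagE sumr_ge0 // => m _; rewrite exprn_ge0.
pose t k := complex.Re (l 0 k).
have lt k : l 0 k = (t k)%:C%C by rewrite /t RRe_real ?ger0_real.
have [k|i j nij ti|c c0 hc] := @centered_spread R d alpha t d0 a0.
- by rewrite -(lecR 0) -lt l0.
- have := gentle_eigenvalue_gap hg hP hL nij; rewrite !lt => h.
  have /h : 0 < (t i)%:C%C by rewrite (ltcR 0).
  by rewrite -rmorphB -rmorphD -rmorphM lecR.
exists c => // x; set y := P *m x.
have hx : (x^t* *m x) 0 0 = \sum_k `|y k 0| ^+ 2.
  rewrite -gram_diagE /y trmxC_mul mulmxA -(mulmxA _ (P^t*)) unitaryC //.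
  by rewrite mulmx1.
rewrite hx; split.
  have -> : x^t* *m E *m x = y^t* *m diag_mx l *m y.
    by rewrite hE /y trmxC_mul !mulmxA.
  rewrite mulr_sumr mxE; apply: ler_sum => k _.
  rewrite mul_mx_diag !mxE lt mulrAC -normCKC mulrC.
  rewrite ler_wpM2l ?exprn_ge0 // lecR.
  by have := hc k; rewrite ler_norml => /andP[]; lra.
set z := E *m x - _; have -> : z = P^t* *m (\col_k ((t k - c)%:C%C * y k 0)).
  rewrite /z.
  have -> : (\col_k ((t k - c)%:C%C * y k 0)) = diag_mx l *m y - c%:C%C *: y.
    by apply/matrixP => k j; rewrite mul_diag_mx !mxE lt ord1 rmorphB mulrBl.
  by rewrite mulmxBr -scalemxAr /y !mulmxA unitaryC // mul1mx hE.
rewrite trmxC_mul trmxCK mulmxA -(mulmxA _ P) (unitarymxP hP) mulmx1 gram_diagE.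
rewrite mulr_sumr; apply: ler_sum => k _.
rewrite mxE normrM exprMn ler_wpM2r ?exprn_ge0 //.
rewrite normc_def /= expr0n addr0 sqrtr_sqr -rmorphXn lecR ler_sqr ?nnegrE //.
by rewrite mulr_ge0 // mulr_ge0 // ltW.
Qed.

(** * Outcome probabilities as real quadratic forms *)

Lemma ReD (R : realType) (x y : R[i]) :
  complex.Re (x + y) = complex.Re x + complex.Re y.
Proof. by case: x; case: y. Qed.

Lemma Re_sum (R : realType) (I : Type) (r : seq I) (P : pred I)
    (F : I -> R[i]) :
  complex.Re (\sum_(i <- r | P i) F i) = \sum_(i <- r | P i) complex.Re (F i).
Proof. by apply: (big_morph _ (@ReD R)). Qed.

Lemma ReZ (R : realType) (a : R) (x : R[i]) :
  complex.Re (a%:C%C * x) = a * complex.Re x.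
Proof. by case: x => u v /=; rewrite mul0r subr0. Qed.

Lemma ReN (R : realType) (x : R[i]) : complex.Re (- x) = - complex.Re x.
Proof. by case: x. Qed.

Definition cmx (R : realType) (m n : nat) (A : 'M[R]_(m, n)) :
    'M[R[i]]_(m, n) :=
  map_mx (fun a : R => a%:C%C) A.

Definition basis_mx (R : realType) (d : nat) (psi : 'I_d -> 'cV[R[i]]_d) :
    'M[R[i]]_d :=
  \matrix_(a, k) psi k a 0.

Lemma basis_mx_unitary (R : realType) (d : nat) (psi : 'I_d -> 'cV[R[i]]_d) :
  orthonormal_basis psi -> basis_mx psi \is unitarymx.
Proof.
move=> h; apply/unitarymxP/mulmx1C; apply/matrixP => j k.
have /matrixP/(_ 0 0) := h j k; rewrite !mxE mulr1n => <-.
by apply: eq_bigr => a _; rewrite !mxE.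
Qed.

Lemma basis_mx_mul (R : realType) (d : nat) (psi : 'I_d -> 'cV[R[i]]_d)
    (g : 'cV[R[i]]_d) :
  basis_mx psi *m g = \sum_k g k 0 *: psi k.
Proof.
apply/matrixP => a j; rewrite summxE mxE ord1; apply: eq_bigr => k _.
by rewrite !mxE mulrC.
Qed.

Lemma trmxC_cmx (R : realType) (m n : nat) (A : 'M[R]_(m, n)) :
  (cmx A)^t* = cmx A^T.
Proof. by apply/matrixP => a b; rewrite !mxE conj_Creal // complex_real. Qed.

Lemma cmx_norm (R : realType) (n : nat) (g : 'cV[R]_n) :
  ((cmx g)^t* *m cmx g) 0 0 = (\sum_k g k 0 ^+ 2)%:C%C.
Proof.
rewrite gram_diagE rmorph_sum; apply: eq_bigr => k _.
by rewrite mxE rmorphXn -normrX ger0_norm // -rmorphXn lecR sqr_ge0.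
Qed.

Lemma real_amplitude_norm (R : realType) (d : nat) (psi : 'I_d -> 'cV[R[i]]_d)
    (g : 'cV[R]_d) : orthonormal_basis psi ->
  let x := \sum_k (g k 0)%:C%C *: psi k in
  (x^t* *m x) 0 0 = (\sum_k g k 0 ^+ 2)%:C%C.
Proof.
move=> hpsi; have hP := basis_mx_unitary hpsi.
have -> : \sum_k (g k 0)%:C%C *: psi k = basis_mx psi *m cmx g.
  by rewrite basis_mx_mul; apply: eq_bigr => k _; rewrite mxE.
rewrite /= trmxC_mul mulmxA -(mulmxA _ ((basis_mx psi)^t*)) unitaryC // mulmx1.
exact: cmx_norm.
Qed.

(** Amplitudes are taken real, so that a single real symmetric matrix, the real
    part of the effect in the basis [psi], carries everything that is needed
    about an outcome: its probability, a lower bound on it, and its distance to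
    a scalar. *)
Lemma gentle_quadratic_form (R : realType) (W : Type) (d : nat) (alpha : R)
    (psi : 'I_d -> 'cV[R[i]]_d) (M : W -> 'M[R[i]]_d) (w : W) :
  (0 < d)%N -> 0 < alpha -> orthonormal_basis psi -> gentle alpha M ->
  exists (c : R) (S : 'M[R]_d),
    [/\ 0 <= c, S^T = S & forall g : 'cV[R]_d,
      [/\ outcome_prob M (ketbra (\sum_k (g k 0)%:C%C *: psi k)) w
            = (g^T *m S *m g) 0 0,
          (1 - 2 * alpha) * c * \sum_k g k 0 ^+ 2 <= (g^T *m S *m g) 0 0 &
          \sum_k (S *m g - c *: g) k 0 ^+ 2
             <= (2 * alpha * c) ^+ 2 * \sum_k g k 0 ^+ 2]].
Proof.
move=> d0 a0 hpsi hg; set E := effect M w.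
have [c c0 hc] := gentle_effect_near_scalar w d0 a0 hg; rewrite -/E in hc.
have hP := basis_mx_unitary hpsi; set P := basis_mx psi in hP.
pose H := P^t* *m E *m P; pose S := map_mx (@complex.Re R) H.
have Hh : H^t* = H.
  by rewrite /H /E /effect !trmxC_mul !trmxCK !mulmxA.
have ReJ (z : R[i]) : complex.Re z^* = complex.Re z by case: z.
exists c, S; split=> //.
  apply/matrixP => a b; rewrite mxE [LHS]mxE [RHS]mxE -[in LHS]Hh mxE ReJ.
  by rewrite mxE.
move=> g; set x := P *m cmx g.
have hx : \sum_k (g k 0)%:C%C *: psi k = x.
  by rewrite /x basis_mx_mul; apply: eq_bigr => k _; rewrite mxE.
have nx : (x^t* *m x) 0 0 = (\sum_k g k 0 ^+ 2)%:C%C.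
  by rewrite -hx real_amplitude_norm.
have [h1 h2] := hc x.
have qx : complex.Re ((x^t* *m E *m x) 0 0) = (g^T *m S *m g) 0 0.
  have -> : x^t* *m E *m x = cmx g^T *m H *m cmx g.
    by rewrite /x trmxC_mul trmxC_cmx /H !mulmxA.
  rewrite mxE Re_sum mxE; apply: eq_bigr => k _.
  rewrite [cmx g k 0]mxE mulrC ReZ mulrC; congr (_ * _).
  rewrite mxE Re_sum mxE; apply: eq_bigr => l _.
  by rewrite !mxE ReZ.
split.
- by rewrite /outcome_prob hx /ketbra -mulmxA mxtrace_mulC trace_mx11 qx.
- move: h1; rewrite nx -rmorphM lecE => /andP[_]; rewrite qx; exact: id.
- have -> : \sum_k (S *m g - c *: g) k 0 ^+ 2
     = \sum_k complex.Re ((P^t* *m (E *m x - c%:C%C *: x)) k 0) ^+ 2.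
    apply: eq_bigr => k _; congr (_ ^+ 2).
    rewrite mulmxBr -scalemxAr /x !mulmxA unitaryC // mul1mx -/H.
    rewrite mxE [X in _ = complex.Re X]mxE ReD; congr (_ + _).
      rewrite mxE [X in _ = complex.Re X]mxE Re_sum; apply: eq_bigr => l _.
      rewrite [cmx g l 0]mxE [X in complex.Re X]mulrC ReZ [RHS]mulrC.
      by congr (_ * _); rewrite [LHS]mxE /H !mulmxA.
    by rewrite !mxE ReN ReZ.
  set z := E *m x - _ in h2 *.
  rewrite -lecR; apply: (@le_trans _ _ ((z^t* *m z) 0 0)).
    have -> : z^t* *m z = (P^t* *m z)^t* *m (P^t* *m z).
      by rewrite trmxC_mul trmxCK mulmxA -(mulmxA _ P) (unitarymxP hP) mulmx1.
    rewrite gram_diagE rmorph_sum; apply: ler_sum => k _.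
    by rewrite -add_Re2_Im2 lecR lerDl sqr_ge0.
  by apply: le_trans h2 _; rewrite nx -rmorphM.
Qed.

(** * Assouad's method for product experiments *)

Lemma fprod_distr (R : comPzSemiRingType) (I : finType) (T_ : I -> finType)
    (F : forall i, T_ i -> R) :
  \sum_(t : fprod T_) \prod_i F i (t i) = \prod_i \sum_(w : T_ i) F i w.
Proof.
pose P i := [ffun w : T_ i => F i w].
transitivity (\sum_(t : fprod T_) \prod_(i in I) P i (t i)).
  by apply: eq_bigr => t _; apply: eq_bigr => i _; rewrite ffunE.
have e i : \sum_(w : T_ i) F i w = \sum_(x in tagged_with T_ i) untag 0 (P i) x.
  rewrite -(big_tag (fun i => P i)).
  by apply: eq_bigr => w _; rewrite ffunE.
under [RHS]eq_bigr => i _ do rewrite e.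
by rewrite big_fprod bigA_distr_big_dep.
Qed.

(** A union bound in product form. *)
Lemma prod_ge_1_sub (R : realDomainType) (I : finType) (x : I -> R) :
  (forall i, 0 <= x i <= 1) -> 1 - \sum_i (1 - x i) <= \prod_i x i.
Proof.
move=> hx.
suff [] : 0 <= \prod_i x i <= 1 /\ 1 - \sum_i (1 - x i) <= \prod_i x i by [].
apply: (big_ind2 (fun s p => 0 <= p <= 1 /\ 1 - s <= p)).
- by rewrite ler01 lexx subr0.
- move=> s p t q [/andP[p0 p1] hs] [/andP[q0 q1] ht].
  rewrite mulr_ge0 // mulr_ile1 //; split=> //.
  have : 0 <= (1 - p) * (1 - q) by rewrite mulr_ge0 ?subr_ge0.
  by rewrite mulrBl mulrBr; lra.
- by move=> i _; split; rewrite ?hx // opprB addrC subrK.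
Qed.

(** The right-hand side is at least [P Q / (P + Q)] times [(u - v) ^ 2], the
    value at the best [x].  The left-hand side is a smaller quantity that is
    linear in the affinity and in the two masses, so that it can be summed over
    outcomes. *)
Lemma two_point_bound (R : rcfType) (P Q u v x : R) : 0 <= P -> 0 <= Q ->
  (Num.sqrt P * Num.sqrt Q - (P + Q) / 4) * (u - v) ^+ 2
    <= P * (x - u) ^+ 2 + Q * (x - v) ^+ 2.
Proof.
move=> P0 Q0; rewrite -{2 3}(sqr_sqrtr P0) -{2 3}(sqr_sqrtr Q0).
move: (Num.sqrt P) (Num.sqrt Q) => a b.
set S := a ^+ 2 + b ^+ 2; have S0 : 0 <= S by rewrite addr_ge0 ?sqr_ge0.
have [S00|Sn0] := eqVneq S 0.
  have a0 : a = 0.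
    by apply/eqP; rewrite -sqrf_eq0 eq_le sqr_ge0 andbT -S00 lerDl sqr_ge0.
  have -> : a * b - S / 4 = 0 by rewrite a0 S00 !mul0r subrr.
  by rewrite mul0r; apply: addr_ge0; apply: mulr_ge0; apply: sqr_ge0.
have Sp : 0 < S by rewrite lt_neqAle eq_sym Sn0.
rewrite -subr_ge0 -(pmulr_rge0 _ Sp).
(* The first square is the error at a suboptimal [x], the second one the loss
   in the linearisation of [P Q / (P + Q)]. *)
suff -> : S * (a ^+ 2 * (x - u) ^+ 2 + b ^+ 2 * (x - v) ^+ 2 -
    (a * b - S / 4) * (u - v) ^+ 2)
  = (a ^+ 2 * (x - u) + b ^+ 2 * (x - v)) ^+ 2
    + (a * b - S / 2) ^+ 2 * (u - v) ^+ 2.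
  by apply: addr_ge0; [|apply: mulr_ge0]; apply: sqr_ge0.
by rewrite /S; field.
Qed.

(** Passing from a chi-square to a Hellinger distance: the square root has slope
    at most [1 / (2 sqrt l)] above [l]. *)
Lemma sqrt_sub_sqr_le (R : rcfType) (l P Q : R) : 0 <= l -> l <= P -> l <= Q ->
  4 * l * (Num.sqrt P - Num.sqrt Q) ^+ 2 <= (P - Q) ^+ 2.
Proof.
move=> l0 lP lQ; have P0 := le_trans l0 lP; have Q0 := le_trans l0 lQ.
have -> : (P - Q) ^+ 2
    = (Num.sqrt P + Num.sqrt Q) ^+ 2 * (Num.sqrt P - Num.sqrt Q) ^+ 2.
  rewrite -exprMn; congr (_ ^+ 2).
  by rewrite mulrC -subr_sqr !sqr_sqrtr.
apply: ler_wpM2r; first exact: sqr_ge0.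
have h : l <= Num.sqrt P * Num.sqrt Q.
  rewrite -[l]ger0_norm // -sqrtr_sqr -sqrtrM // ler_wsqrtr // expr2.
  by apply: ler_pM.
by rewrite sqrrD !sqr_sqrtr //; lra.
Qed.

Local Notation cube m := {ffun 'I_m -> bool}.

Definition flip (m : nat) (tau : cube m) (j : 'I_m) : cube m :=
  [ffun k => if k == j then ~~ tau k else tau k].

Lemma flipK (m : nat) (j : 'I_m) : involutive ((@flip m)^~ j).
Proof.
move=> tau; apply/ffunP => k; rewrite !ffunE.
by case: eqP => // _; rewrite negbK.
Qed.

Lemma sum_flip (V : nmodType) (m : nat) (j : 'I_m) (F : cube m -> V) :
  \sum_tau F (flip tau j) = \sum_tau F tau.
Proof. by rewrite [RHS](reindex_inj (inv_inj (flipK j))). Qed.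

Lemma sum_const_card (R : pzSemiRingType) (I : finType) (x : R) :
  \sum_(i : I) x = #|I|%:R * x.
Proof. by rewrite sumr_const mulr_natl. Qed.

Lemma sum_const_ord (R : pzSemiRingType) (n : nat) (x : R) :
  \sum_(i < n) x = n%:R * x.
Proof. by rewrite sum_const_card card_ord. Qed.

(** For each coordinate [j], the hypercube splits into pairs [tau],
    [flip tau j]; each pair is a two-point problem, whose error is governed by
    the affinity of the two product laws.  Only the sum over [j] and the average
    over [tau] of the Hellinger distances are assumed to be small: a bound that
    is uniform in [j] would lose a factor [m].  The laws may miss a mass [eta],
    which allows for the truncation of infinite outcome sets. *)
Lemma assouad_product (R : rcfType) (n m : nat) (T_ : 'I_n -> finType)
    (p : forall i, cube m -> T_ i -> R)
    (est : fprod T_ -> 'I_m -> R) (th : bool -> R) (eta V : R) :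
  (forall i tau w, 0 <= p i tau w) ->
  (forall i tau, \sum_w p i tau w <= 1) ->
  (forall i tau, 1 - eta <= \sum_w p i tau w) ->
  (forall i, \sum_tau \sum_j \sum_w
      (Num.sqrt (p i tau w) - Num.sqrt (p i (flip tau j) w)) ^+ 2
      <= V * #|cube m|%:R) ->
  (th true - th false) ^+ 2 / 4 * (m%:R - 2 * m%:R * n%:R * eta - n%:R * V)
     * #|cube m|%:R
  <= \sum_tau \sum_(t : fprod T_)
        (\prod_i p i tau (t i)) * \sum_j (est t j - th (tau j)) ^+ 2.
Proof.
move=> p0 p1 peta hV; set N := #|_|%:R.
set D := (th true - th false) ^+ 2.
pose pp tau (t : fprod T_) := \prod_i p i tau (t i).
have pp0 (tau : cube m) t : 0 <= pp tau t by apply: prodr_ge0.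
have pp1 (tau : cube m) : \sum_t pp tau t <= 1.
  rewrite (fprod_distr (fun i => p i tau)); apply: prodr_ile1 => i _.
  by rewrite p1 sumr_ge0.
have thE (tau : cube m) j : (th (tau j) - th (flip tau j j)) ^+ 2 = D.
  by rewrite ffunE eqxx /D; case: (tau j) => //=; rewrite -sqrrN opprB.
pose h (i : 'I_n) (tau : cube m) (j : 'I_m) :=
  \sum_w (Num.sqrt (p i tau w) - Num.sqrt (p i (flip tau j) w)) ^+ 2.
(* An affinity is read off a Hellinger distance and the two total masses. *)
have aff i tau j :
   \sum_w Num.sqrt (p i tau w) * Num.sqrt (p i (flip tau j) w)
   = (\sum_w p i tau w + \sum_w p i (flip tau j) w - h i tau j) / 2.
  rewrite /h -big_split -sumrB mulr_suml; apply: eq_bigr => w _ /=.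
  by rewrite sqrrB !sqr_sqrtr //; field.
have bc tau j : 1 - n%:R * eta - (\sum_i h i tau j) / 2
    <= \sum_t Num.sqrt (pp tau t) * Num.sqrt (pp (flip tau j) t).
  (* Affinities multiply over independent outcomes. *)
  have -> : \sum_t Num.sqrt (pp tau t) * Num.sqrt (pp (flip tau j) t)
     = \prod_i \sum_w Num.sqrt (p i tau w) * Num.sqrt (p i (flip tau j) w).
    rewrite -(fprod_distr (fun i w =>
      Num.sqrt (p i tau w) * Num.sqrt (p i (flip tau j) w))).
    apply: eq_bigr => t _; rewrite big_split /=; congr (_ * _).
      rewrite /pp; elim/big_rec2: _ => [|i x y _ <-]; first exact: sqrtr1.
      by rewrite sqrtrM.
    rewrite /pp; elim/big_rec2: _ => [|i x y _ <-]; first exact: sqrtr1.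
    by rewrite sqrtrM.
  apply: le_trans (prod_ge_1_sub _); last first.
    move=> i; apply/andP; split.
      by apply: sumr_ge0 => w _; rewrite mulr_ge0 ?sqrtr_ge0.
    have hh : 0 <= h i tau j by apply: sumr_ge0 => w _; apply: sqr_ge0.
    have := p1 i tau; have := p1 i (flip tau j); rewrite aff; lra.
  rewrite mulr_suml -addrA -opprD lerD2l lerN2.
  have -> : n%:R * eta = \sum_(i < n) eta by rewrite sum_const_ord.
  rewrite -big_split /=; apply: ler_sum => i _.
  have := peta i tau; have := peta i (flip tau j); rewrite aff; lra.
have key j :
   D / 2 * \sum_tau (1 / 2 - n%:R * eta - (\sum_i h i tau j) / 2)
   <= \sum_tau \sum_t pp tau t * (est t j - th (tau j)) ^+ 2.
  pose L tau := \sum_t pp tau t * (est t j - th (tau j)) ^+ 2.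
  have -> : \sum_tau L tau = (\sum_tau (L tau + L (flip tau j))) / 2.
    by rewrite big_split /= (sum_flip j L); field.
  rewrite ler_pdivlMr // mulrAC divfK // mulr_sumr; apply: ler_sum => tau _.
  rewrite -big_split /=.
  apply: (@le_trans _ _ (\sum_t
      (Num.sqrt (pp tau t) * Num.sqrt (pp (flip tau j) t)
      - (pp tau t + pp (flip tau j) t) / 4) * D)); last first.
    apply: ler_sum => t _; rewrite -(thE tau j).
    exact: two_point_bound.
  rewrite -mulr_suml mulrC ler_wpM2r ?sqr_ge0 //.
  rewrite sumrB -mulr_suml big_split /=.
  have := bc tau j; have := pp1 tau; have := pp1 (flip tau j); lra.
have -> : \sum_tau \sum_(t : fprod T_)
    (\prod_i p i tau (t i)) * \sum_j (est t j - th (tau j)) ^+ 2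
  = \sum_j \sum_tau \sum_t pp tau t * (est t j - th (tau j)) ^+ 2.
  rewrite [RHS]exchange_big; apply: eq_bigr => tau _ /=.
  rewrite [RHS]exchange_big; apply: eq_bigr => t _ /=.
  by rewrite mulr_sumr.
apply: le_trans (ler_sum _ (fun j _ => key j)).
rewrite -mulr_sumr.
have -> : \sum_j \sum_tau (1 / 2 - n%:R * eta - (\sum_i h i tau j) / 2)
   = m%:R * (N * (1 / 2 - n%:R * eta)) - (\sum_i \sum_tau \sum_j h i tau j) / 2.
  under eq_bigr => j _ do rewrite sumrB sum_const_card -mulr_suml -/N.
  rewrite sumrB sum_const_ord -mulr_suml; congr (_ - _ / 2).
  rewrite exchange_big /=; under eq_bigr => tau _ do rewrite exchange_big.
  exact: exchange_big.
have hsum : \sum_i \sum_tau \sum_j h i tau j <= n%:R * (V * N).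
  apply: le_trans (ler_sum _ (fun i _ => hV i)) _.
  by rewrite sum_const_ord.
have D0 : 0 <= D by apply: sqr_ge0.
rewrite -subr_ge0 (_ : _ - _ = D / 4
  * (n%:R * (V * N) - \sum_i \sum_tau \sum_j h i tau j)); last by field.
by rewrite mulr_ge0 ?divr_ge0 // subr_ge0.
Qed.

(** * The hypercube of states *)

(** The bit [tau j] decides which of the two coordinates of the pair [j] has
    amplitude [a + b] and which has [a - b].  The last [r] coordinates are
    empty; [r] stands for the parity of the dimension. *)
Definition cube_amplitude (R : pzRingType) (m r : nat) (a b : R)
    (tau : cube m) : 'cV[R]_(m + m + r) :=
  col_mx (col_mx (\col_j (a + (-1) ^+ tau j * b))
                 (\col_j (a - (-1) ^+ tau j * b))) 0.

Lemma cube_amplitudeE (R : pzRingType) (m r : nat) (a b : R)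
    (tau : cube m) :
  [/\ forall j, cube_amplitude r a b tau (lshift r (lshift m j)) 0
        = a + (-1) ^+ tau j * b,
      forall j, cube_amplitude r a b tau (lshift r (rshift m j)) 0
        = a - (-1) ^+ tau j * b &
      forall k, cube_amplitude r a b tau (rshift (m + m) k) 0 = 0].
Proof.
split=> j; rewrite /cube_amplitude;
  by rewrite ?col_mxEd ?col_mxEu ?col_mxEd ?col_mxEu mxE.
Qed.

Lemma cube_amplitude_norm (R : comPzRingType) (m r : nat) (a b : R)
    (tau : cube m) :
  \sum_k cube_amplitude r a b tau k 0 ^+ 2 = (2 * m)%:R * (a ^+ 2 + b ^+ 2).
Proof.
have [e1 e2 e3] := cube_amplitudeE r a b tau.
rewrite !big_split_ord /= [X in _ + _ + X]big1 ?addr0; last first.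
  by move=> k _; rewrite e3 expr0n.
rewrite -big_split /=.
transitivity (\sum_(j < m) 2 * (a ^+ 2 + b ^+ 2)).
  by apply: eq_bigr => j _; rewrite e1 e2; case: (tau j); ring.
by rewrite sum_const_ord natrM; ring.
Qed.

Lemma cube_amplitude_flip (R : comPzRingType) (m r : nat) (a b : R)
    (tau : cube m) (j : 'I_m) (y : 'cV[R]_(m + m + r)) :
  ((cube_amplitude r a b tau - cube_amplitude r a b (flip tau j))^T *m y) 0 0
    = 2 * (-1) ^+ tau j * b
      * (y (lshift r (lshift m j)) 0 - y (lshift r (rshift m j)) 0).
Proof.
have [e1 e2 e3] := cube_amplitudeE r a b tau.
have [f1 f2 f3] := cube_amplitudeE r a b (flip tau j).
have tB (x z : 'cV[R]_(m + m + r)) k : (x - z)^T 0 k = x k 0 - z k 0.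
  by rewrite !mxE.
rewrite mxE !big_split_ord /= [X in _ + _ + X]big1 ?addr0; last first.
  by move=> k _; rewrite tB e3 f3 subrr mul0r.
rewrite -big_split /= (bigD1 j) //= big1 ?addr0; last first.
  move=> k nk; rewrite !tB e1 f1 e2 f2 ffunE (negPf nk).
  by rewrite !subrr !mul0r addr0.
rewrite !tB e1 f1 e2 f2 ffunE eqxx.
by case: (tau j) => /=; ring.
Qed.

(** Two vectors of the same norm give the same value to the scalar part [c] of
    the form, which can therefore be subtracted. *)
Lemma quadratic_form_sub (R : comPzRingType) (d : nat) (c : R) (S : 'M[R]_d)
    (g h : 'cV[R]_d) :
  S^T = S -> (g^T *m g) 0 0 = (h^T *m h) 0 0 ->
  (g^T *m S *m g) 0 0 - (h^T *m S *m h) 0 0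
    = ((g - h)^T *m ((S *m g - c *: g) + (S *m h - c *: h))) 0 0.
Proof.
move=> hS hn; rewrite -!mulmxA.
have symf (x y : 'cV[R]_d) : (x^T *m y) 0 0 = (y^T *m x) 0 0.
  by rewrite -[LHS]trace_mx11 -mxtrace_tr trmx_mul trmxK trace_mx11.
have sw : (h^T *m (S *m g)) 0 0 = (g^T *m (S *m h)) 0 0.
  by rewrite symf trmx_mul hS mulmxA.
have Dl (x y z : 'cV[R]_d) :
    ((x - y)^T *m z) 0 0 = (x^T *m z) 0 0 - (y^T *m z) 0 0.
  by rewrite linearB /= mulmxBl [LHS]mxE [X in _ + X]mxE.
have Dr (x y z u v : 'cV[R]_d) :
    (x^T *m ((y - c *: z) + (u - c *: v))) 0 0
      = (x^T *m y) 0 0 - c * (x^T *m z) 0 0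
      + ((x^T *m u) 0 0 - c * (x^T *m v) 0 0).
  have Zr (p q : 'cV[R]_d) :
      (x^T *m (p - c *: q)) 0 0 = (x^T *m p) 0 0 - c * (x^T *m q) 0 0.
    by rewrite mulmxBr -scalemxAr [LHS]mxE [X in _ + X]mxE [X in - X]mxE.
  by rewrite mulmxDr [LHS]mxE !Zr.
rewrite Dl !Dr (symf h g) -sw hn; ring.
Qed.

(** Flipping the bit [j] moves the amplitudes along the pair [j] only, so the
    [j]-th increment reads just two coordinates of [S g - c g] at each end of
    the edge.  Over all [j] these coordinates are disjoint, and their squares
    add up to at most [B]: no factor [m] appears.  Both ends of the edges
    contribute equally once summed over the hypercube. *)
Lemma cube_form_variation (R : realFieldType) (m r : nat) (a b c B : R)
    (S : 'M[R]_(m + m + r)) :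
  S^T = S ->
  let g := cube_amplitude r a b in
  (forall tau, \sum_k (S *m g tau - c *: g tau) k 0 ^+ 2 <= B) ->
  \sum_(tau : cube m) \sum_j
      (((g tau)^T *m S *m g tau) 0 0
        - ((g (flip tau j))^T *m S *m g (flip tau j)) 0 0) ^+ 2
    <= 32 * b ^+ 2 * B * #|cube m|%:R.
Proof.
move=> hS g hB; pose u tau := S *m g tau - c *: g tau.
pose e tau j := u tau (lshift r (lshift m j)) 0 ^+ 2
  + u tau (lshift r (rshift m j)) 0 ^+ 2.
have gn tau : ((g tau)^T *m g tau) 0 0 = (2 * m)%:R * (a ^+ 2 + b ^+ 2).
  rewrite -(cube_amplitude_norm r a b tau) mxE.
  by apply: eq_bigr => k _; rewrite mxE expr2.
have he tau : \sum_j e tau j <= B.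
  apply: le_trans (hB tau); rewrite !big_split_ord /= -big_split /= lerDl.
  by apply: sumr_ge0 => k _; apply: sqr_ge0.
apply: (@le_trans _ _
  (\sum_tau \sum_j 16 * b ^+ 2 * (e tau j + e (flip tau j) j))).
  apply: ler_sum => tau _; apply: ler_sum => j _.
  rewrite (quadratic_form_sub c) ?gn // -/(u tau) -/(u (flip tau j)).
  rewrite cube_amplitude_flip !exprMn sqrr_sign mulr1.
  rewrite [in leLHS]mxE [X in _ - X]mxE /e.
  move: (u tau _ _) (u tau _ _) (u (flip tau j) _ _) (u (flip tau j) _ _).
  move=> x y z w.
  rewrite -subr_ge0 (_ : _ - _ = 4 * b ^+ 2 * ((y - w) ^+ 2 + (y + x) ^+ 2
    + (y + z) ^+ 2 + (w + x) ^+ 2 + (w + z) ^+ 2 + (x - z) ^+ 2)); last by ring.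
  apply: mulr_ge0; first by apply: mulr_ge0; rewrite ?sqr_ge0.
  by rewrite !addr_ge0 ?sqr_ge0.
have -> : \sum_tau \sum_j 16 * b ^+ 2 * (e tau j + e (flip tau j) j)
   = 32 * b ^+ 2 * \sum_tau \sum_j e tau j.
  rewrite exchange_big /=.
  have ej j : \sum_tau 16 * b ^+ 2 * (e tau j + e (flip tau j) j)
      = 32 * b ^+ 2 * \sum_tau e tau j.
    by rewrite -mulr_sumr big_split /= (sum_flip j (e^~ j)); ring.
  under eq_bigr => j _ do rewrite ej.
  by rewrite -mulr_sumr exchange_big.
rewrite -[leRHS]mulrA; apply: ler_wpM2l.
  by apply: mulr_ge0; rewrite ?sqr_ge0.
rewrite mulrC -sum_const_card; exact: ler_sum.
Qed.

(** The increments are relative to [c w], which is also, up to the factor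
    [1 - 2 alpha], a lower bound for all the probabilities of [w]; hence the
    weights [c w] have a total of at most [1 / (1 - 2 alpha)]. *)
Lemma hellinger_variation (R : rcfType) (m : nat) (T : finType) (alpha b : R)
    (c : T -> R) (p : cube m -> T -> R) :
  alpha < 1 / 2 -> (forall w, 0 <= c w) ->
  (forall tau w, (1 - 2 * alpha) * c w <= p tau w) ->
  (forall tau, \sum_w p tau w <= 1) ->
  (forall w, \sum_tau \sum_j (p tau w - p (flip tau j) w) ^+ 2
      <= 32 * b ^+ 2 * (2 * alpha * c w) ^+ 2 * #|cube m|%:R) ->
  \sum_tau \sum_j \sum_w (Num.sqrt (p tau w) - Num.sqrt (p (flip tau j) w)) ^+ 2
    <= 32 * b ^+ 2 * alpha ^+ 2 / (1 - 2 * alpha) ^+ 2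
       * #|cube m|%:R.
Proof.
move=> a1 c0 pl p1 hp; set N := #|_|%:R; have k0 : 0 < 1 - 2 * alpha by lra.
pose h tau j w := (Num.sqrt (p tau w) - Num.sqrt (p (flip tau j) w)) ^+ 2.
have -> : \sum_tau \sum_j \sum_w h tau j w = \sum_w \sum_tau \sum_j h tau j w.
  under eq_bigr => tau _ do rewrite exchange_big.
  by rewrite exchange_big.
have C0 : 0 <= 32 * b ^+ 2 * alpha ^+ 2 / (1 - 2 * alpha) * N.
  apply: mulr_ge0 => //; apply: divr_ge0; last exact: ltW.
  by apply: mulr_ge0; [apply: mulr_ge0|]; rewrite ?sqr_ge0.
apply: (@le_trans _ _
  (\sum_w 32 * b ^+ 2 * alpha ^+ 2 / (1 - 2 * alpha) * N * c w)); last first.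
  rewrite -mulr_sumr.
  have hc : \sum_w c w <= (1 - 2 * alpha)^-1.
    rewrite -[_^-1]mul1r ler_pdivlMr // mulrC mulr_sumr.
    apply: le_trans (p1 [ffun=> true]); exact: ler_sum.
  apply: le_trans (ler_wpM2l C0 hc) _.
  by rewrite le_eqVlt; apply/orP; left; apply/eqP; field; rewrite gt_eqF.
apply: ler_sum => w _.
(* If [c w = 0], the increments vanish and nothing has to be divided by. *)
have [cw|cw] := eqVneq (c w) 0.
  rewrite cw mulr0 [leLHS]big1 // => tau _; rewrite big1 // => j _.
  have := hp w; rewrite cw !mulr0 expr0n mulr0 mul0r => h0.
  suff e : p tau w = p (flip tau j) w by rewrite /h e subrr expr0n.
  apply/eqP; rewrite -subr_eq0 -sqrf_eq0 eq_le sqr_ge0 andbT.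
  apply: le_trans h0; rewrite (bigD1 tau) //= (bigD1 j) //= -addrA lerDl.
  rewrite addr_ge0 // ?sumr_ge0 // => *; rewrite ?sumr_ge0 // => *;
  exact: sqr_ge0.
have cp : 0 < c w by rewrite lt_neqAle eq_sym cw c0.
have l0 : 0 < 4 * ((1 - 2 * alpha) * c w) by rewrite !mulr_gt0.
rewrite -(ler_pM2l l0) mulr_sumr.
under eq_bigr => tau _ do rewrite mulr_sumr.
apply: le_trans (le_trans _ (hp w)) _.
  apply: ler_sum => tau _; apply: ler_sum => j _.
  apply: sqrt_sub_sqr_le; rewrite ?pl //.
  by rewrite mulr_ge0 // ltW.
by rewrite -/N le_eqVlt; apply/orP; left; apply/eqP; field; rewrite gt_eqF.
Qed.

(** * Countably many outcomes *)

Lemma has_sum_near (K : numFieldType) (I : choiceType) (x : I -> K) (l e : K) :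
  has_sum x l -> 0 < e ->
  exists F0 : {fset I}, forall F : {fset I}, fsubset F0 F ->
    `|l - \sum_(i <- F) x i| < e.
Proof.
move=> h e0; have hx := (cvgrPdist_lt _ _).1 h.
have [A _ hA] := hx (@totally_filter I) e e0.
by exists A => F AF; apply: hA.
Qed.

Lemma common_fset (T : finType) (I : choiceType) (Q : T -> {fset I} -> Prop) :
  (forall t, exists F0, forall F, fsubset F0 F -> Q t F) ->
  exists F0, forall F, fsubset F0 F -> forall t, Q t F.
Proof.
move=> /choice[G hG]; exists (\big[@fsetU I/fset0]_(t : T) G t) => F hF t.
apply: hG; apply: fsubset_trans hF.
exact: (@bigfcup_sup I T (index_enum T) t predT G).
Qed.

Lemma big_fset_val (V : nmodType) (I : choiceType) (F : {fset I}) (x : I -> V) :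
  \sum_(w : F) x (val w) = \sum_(w <- F) x w.
Proof. by rewrite big_seq_fsetE. Qed.

(** Probabilities are linear in the finitely many entries of the effects. *)
Lemma measurement_prob_near (R : realType) (W : countType) (d : nat)
    (M : W -> 'M[R[i]]_d) (rho : 'M[R[i]]_d) (eta : R) :
  measurement M -> \tr rho = 1 -> 0 < eta ->
  exists F0 : {fset W}, forall F : {fset W}, fsubset F0 F ->
    `|1 - \sum_(w <- F) outcome_prob M rho w| <= eta.
Proof.
move=> hM htr eta0.
pose C := \sum_j \sum_k `|rho j k|.
have C0 : 0 <= C by apply: sumr_ge0 => j _; apply: sumr_ge0.
pose e := eta%:C%C / (1 + C).
have C1 : 0 < 1 + C by rewrite ltr_wpDr.
have e0 : 0 < e by rewrite divr_gt0 // (ltcR 0).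
have h (t : 'I_d * 'I_d) : exists F0 : {fset W}, forall F, fsubset F0 F ->
    `|(1%:M : 'M[R[i]]_d) t.1 t.2 - \sum_(w <- F) effect M w t.1 t.2| < e.
  exact: has_sum_near (hM _ _) e0.
have [F0 hF0] := common_fset h; exists F0 => F hF.
have -> : 1 - \sum_(w <- F) outcome_prob M rho w
    = complex.Re (\tr (rho *m (1%:M - \sum_(w <- F) effect M w))).
  rewrite mulmxBr mulmx1 mulmx_sumr linearB /= htr ReD ReN; congr (_ - _).
  rewrite (big_morph _ (@mxtraceD _ _) (@mxtrace0 _ _)) Re_sum.
  by [].
rewrite -lecR; apply: le_trans (normc_ge_Re _) _.
rewrite /mxtrace; apply: le_trans (ler_norm_sum _ _ _) _.
apply: (@le_trans _ _ (C * e)); last first.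
  rewrite /e mulrCA ger_pMr ?(ltcR 0) // ler_pdivrMr // mul1r lerDr //.
rewrite /C mulr_suml; apply: ler_sum => j _; rewrite mxE.
apply: le_trans (ler_norm_sum _ _ _) _.
rewrite mulr_suml; apply: ler_sum => k _.
rewrite normrM ler_wpM2l //; apply: ltW.
have -> : (1%:M - \sum_(w <- F) effect M w) k j
    = (1%:M : 'M[R[i]]_d) k j - \sum_(w <- F) effect M w k j.
  by rewrite [LHS]mxE [X in _ + X]mxE summxE.
exact: (hF0 F hF (k, j)).
Qed.

(** Partial sums grow with the index set, and the late ones are close to [1]. *)
Lemma measurement_prob_sum_le1 (R : realType) (W : countType) (d : nat)
    (M : W -> 'M[R[i]]_d) (rho : 'M[R[i]]_d) (F : {fset W}) :
  measurement M -> \tr rho = 1 -> (forall w, 0 <= outcome_prob M rho w) ->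
  \sum_(w <- F) outcome_prob M rho w <= 1.
Proof.
move=> hM htr p0; apply/ler_addgt0Pr => eta eta0.
have [F0 hF0] := measurement_prob_near hM htr eta0.
have := hF0 (F0 `|` F)%fset (fsubsetUl _ _); rewrite ler_norml => /andP[h _].
apply: (@le_trans _ _ (\sum_(w <- (F0 `|` F)%fset) outcome_prob M rho w));
  last by lra.
rewrite [leRHS](big_fsetID _ (mem F)) /=.
have -> : [fset x in (F0 `|` F)%fset | x \in F]%fset = F.
  by apply/fsetP => w; rewrite !inE; case: (w \in F); rewrite ?orbT ?andbF.
by rewrite lerDl sumr_ge0.
Qed.

Lemma esum_ge_inj (R : realType) (T : finType) (W : choiceType) (emb : T -> W)
    (f : W -> R) :
  injective emb ->
  ((\sum_t f (emb t))%:E <= \esum_(w in [set: W]) (f w)%:E)%E.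
Proof.
move=> hi; apply: esum_ge; pose F := [fset emb t | t in T]%fset.
exists [set` F]; first by split => //; exact: finite_fset.
rewrite fsbig_finite /=; last exact: finite_fset.
rewrite set_fsetK /F big_imfset /=; last by move=> a b _ _; apply: hi.
by rewrite sumEFin lee_fin big_enum.
Qed.

(** * Tensor products *)

Lemma tensmxn_mul (R : realType) (n d : nat) (A B : 'I_n -> 'M[R[i]]_d) :
  tensmxn A *m tensmxn B = tensmxn (fun i => A i *m B i).
Proof.
apply/matrixP => a b; rewrite !mxE.
pose at_ (c : 'I_#|{ffun 'I_n -> 'I_d}|) i := (enum_val c : {ffun _ -> 'I_d}) i.
rewrite (eq_bigr (fun i => \sum_k A i (at_ a i) k * B i k (at_ b i))).
  2: by move=> i _; rewrite mxE.
rewrite bigA_distr_bigA /=.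
rewrite (reindex (fun c : 'I_#|{ffun 'I_n -> 'I_d}| => enum_val c)) /=;
  last exact/onW_bij/enum_val_bij.
by apply: eq_bigr => c _; rewrite !mxE -big_split.
Qed.

Lemma tensmxn_adj (R : realType) (n d : nat) (A : 'I_n -> 'M[R[i]]_d) :
  (tensmxn A)^t* = tensmxn (fun i => (A i)^t*).
Proof.
apply/matrixP => a b; rewrite !mxE rmorph_prod; apply: eq_bigr => i _.
by rewrite !mxE.
Qed.

Lemma tensmxn_tr (R : realType) (n d : nat) (A : 'I_n -> 'M[R[i]]_d) :
  \tr (tensmxn A) = \prod_i \tr (A i).
Proof.
rewrite bigA_distr_bigA /=.
rewrite (reindex (fun c : 'I_#|{ffun 'I_n -> 'I_d}| => enum_val c)) /=;
  last exact/onW_bij/enum_val_bij.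
by apply: eq_bigr => c _; rewrite !mxE.
Qed.

Lemma tr_ketbra_effect_ge0 (R : realType) (W : Type) (d : nat)
    (M : W -> 'M[R[i]]_d) (x : 'cV[R[i]]_d) (w : W) :
  0 <= \tr (ketbra x *m effect M w).
Proof.
rewrite /ketbra /effect -mulmxA mxtrace_mulC trace_mx11.
have -> : x^t* *m ((M w)^t* *m M w) *m x = (M w *m x)^t* *m (M w *m x).
  by rewrite trmxC_mul !mulmxA.
by rewrite gram_diagE sumr_ge0 // => k _; rewrite exprn_ge0.
Qed.

(** The traces of the factors are real, so that taking the real part commutes
    with their product. *)
Lemma outcome_prob_tensor (R : realType) (n d : nat) (W : 'I_n -> countType)
    (M : forall i, W i -> 'M[R[i]]_d) (x : 'cV[R[i]]_d)
    (w : {dffun forall i : 'I_n, W i}) :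
  outcome_prob (tensor_measurement M) (tensmxn (fun _ : 'I_n => ketbra x)) w
    = \prod_i outcome_prob (M i) (ketbra x) (w i).
Proof.
rewrite {1}/outcome_prob /effect /tensor_measurement.
rewrite tensmxn_adj !tensmxn_mul tensmxn_tr.
rewrite (eq_bigr (fun i => (outcome_prob (M i) (ketbra x) (w i))%:C%C)).
  by rewrite -rmorph_prod.
move=> i _; rewrite RRe_real // ger0_real //.
exact: (tr_ketbra_effect_ge0 (M i) x (w i)).
Qed.

(** * The lower bound *)

Lemma tr_ketbra (R : realType) (d : nat) (x : 'cV[R[i]]_d) :
  \tr (ketbra x) = (x^t* *m x) 0 0.
Proof. by rewrite /ketbra mxtrace_mulC trace_mx11. Qed.

Lemma pure_ketbra (R : realType) (d : nat) (x : 'cV[R[i]]_d) :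
  (x^t* *m x) 0 0 = 1 -> pure_state (ketbra x).
Proof.
move=> hx; have htr : \tr (ketbra x) = 1 by rewrite tr_ketbra.
split; first split=> // v.
  have -> : v^t* *m ketbra x *m v = (x^t* *m v)^t* *m (x^t* *m v).
    by rewrite /ketbra trmxC_mul trmxCK !mulmxA.
  by rewrite gram_diagE sumr_ge0 // => k _; rewrite exprn_ge0.
apply/eqP; rewrite eqn_leq; apply/andP; split.
  by apply: leq_trans (mxrankM_maxl _ _) _; apply: rank_leq_col.
rewrite lt0n mxrank_eq0; apply/eqP => h0; move: htr; rewrite h0 mxtrace0.
by move=> /eqP; rewrite eq_sym oner_eq0.
Qed.

(** What one gentle measurement provides for Assouad's method.  The finite set
    [F] of outcomes is the same for all states of the hypercube. *)
Lemma cube_state_statistics (R : realType) (m r : nat) (alpha a b eta : R)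
    (psi : 'I_(m + m + r) -> 'cV[R[i]]_(m + m + r)) (W : countType)
    (M : W -> 'M[R[i]]_(m + m + r)) :
  (0 < m)%N -> 0 < alpha -> alpha < 1 / 2 -> orthonormal_basis psi ->
  (2 * m)%:R * (a ^+ 2 + b ^+ 2) = 1 -> 0 < eta ->
  measurement M -> gentle alpha M ->
  let p tau w := outcome_prob M
    (ketbra (\sum_k (cube_amplitude r a b tau k 0)%:C%C *: psi k)) w in
  exists F : {fset W},
    [/\ forall tau, \sum_(w : F) p tau (val w) <= 1,
        forall tau, 1 - eta <= \sum_(w : F) p tau (val w) &
        \sum_tau \sum_j \sum_(w : F)
          (Num.sqrt (p tau (val w)) - Num.sqrt (p (flip tau j) (val w))) ^+ 2
        <= 32 * b ^+ 2 * alpha ^+ 2 / (1 - 2 * alpha) ^+ 2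
           * #|cube m|%:R].
Proof.
move=> m0 a0 a1 hpsi hab eta0 hM hg p.
have d0 : (0 < m + m + r)%N by rewrite -addnA ltn_addr.
pose x tau := \sum_k (cube_amplitude r a b tau k 0)%:C%C *: psi k.
have htr tau : \tr (ketbra (x tau)) = 1.
  by rewrite tr_ketbra real_amplitude_norm // cube_amplitude_norm hab.
have pge0 tau w : 0 <= p tau w.
  by have := tr_ketbra_effect_ge0 M (x tau) w; rewrite lecE => /andP[].
have near (tau : cube m) : exists F0 : {fset W}, forall F,
    fsubset F0 F -> `|1 - \sum_(w <- F) p tau w| <= eta.
  exact: (measurement_prob_near hM (htr tau) eta0).
have [F hF] := common_fset near.
have hq w := gentle_quadratic_form w d0 a0 hpsi hg.
have [c hc] := choice hq; have [S hS] := choice hc.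
have pE tau w : p tau w
    = ((cube_amplitude r a b tau)^T *m S w *m cube_amplitude r a b tau) 0 0.
  by have [_ _ h] := hS w; have [] := h (cube_amplitude r a b tau).
have p1 tau : \sum_(w : F) p tau (val w) <= 1.
  rewrite (big_fset_val _ (p tau)).
  exact: (measurement_prob_sum_le1 F hM (htr tau) (pge0 tau)).
exists F; split=> // [tau|].
  rewrite (big_fset_val _ (p tau)); have := hF F (fsubset_refl _) tau.
  by rewrite ler_norml => /andP[_]; lra.
apply: (@hellinger_variation R m F alpha b (fun w => c (val w))
  (fun tau w => p tau (val w))) => //.
- by move=> w; have [] := hS (val w).
- move=> tau w; have [_ _ h] := hS (val w).
  have [_ h1 _] := h (cube_amplitude r a b tau).
  by move: h1; rewrite cube_amplitude_norm hab mulr1 -pE.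
- move=> w; have [c0 hsym h] := hS (val w).
  under eq_bigr => tau _ do under eq_bigr => j _ do rewrite !pE.
  apply: (cube_form_variation (c := c (val w))) => // tau.
  have [_ _ h2] := h (cube_amplitude r a b tau).
  by move: h2; rewrite cube_amplitude_norm hab mulr1.
Qed.

(** The free parameter [s] is the share of the perturbation in the total weight:
    [b ^ 2 = s / (2 m)] and [a ^ 2 = (1 - s) / (2 m)].  The right-hand side is
    [s (1 - s) (7/8 - K s) / m], where [K] is the information of the [n] copies
    per unit of [s].  If [K <= 1], the bits stay hidden at the maximal useful
    perturbation [s = 1/2]; otherwise [s = 1 / (2 K)] keeps [K s] at [1/2]. *)
Lemma rate_arithmetic (R : realFieldType) (m n d alpha : R) :
  1 <= m -> 1 <= n -> 2 * m <= d -> d <= 3 * m -> 0 < alpha -> alpha < 1 / 2 ->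
  exists s, [/\ 0 <= s, s <= 1 &
    Num.min (1 / (8 * d)) ((1 - 2 * alpha) ^+ 4 * d / (1024 * n * alpha ^+ 2))
    <= 4 * ((1 - s) / (2 * m)) * (s / (2 * m))
       * (m - 2 * m * n * (1 / (16 * n))
          - n * (32 * (s / (2 * m)) * alpha ^+ 2 / (1 - 2 * alpha) ^+ 2))].
Proof.
move=> m1 n1 dm1 dm2 a0 a1.
have m0 : 0 < m by lra.
have n0 : 0 < n by lra.
have d0 : 0 < d by lra.
have k0 : 0 < 1 - 2 * alpha by lra.
have mn : m != 0 by rewrite gt_eqF.
have nn : n != 0 by rewrite gt_eqF.
have kn : 1 - 2 * alpha != 0 by rewrite gt_eqF.
have an : alpha != 0 by rewrite gt_eqF.
have [K defK] : exists K,
    K = 16 * n * alpha ^+ 2 / (m ^+ 2 * (1 - 2 * alpha) ^+ 2) by eexists.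
have K0 : 0 < K by rewrite defK divr_gt0 // !mulr_gt0 // exprn_gt0.
have Kn : K != 0 by rewrite gt_eqF.
have E s : 4 * ((1 - s) / (2 * m)) * (s / (2 * m))
       * (m - 2 * m * n * (1 / (16 * n))
          - n * (32 * (s / (2 * m)) * alpha ^+ 2 / (1 - 2 * alpha) ^+ 2))
   = s * (1 - s) / m * (7 / 8 - K * s).
  by rewrite defK; field; rewrite mn nn kn.
have [K1|K1] := leP K 1.
  exists (1 / 2); split; [lra|lra|]; rewrite ge_min; apply/orP; left; rewrite E.
  apply: (@le_trans _ _ (1 / 2 * (1 - 1 / 2) / m * (3 / 8))); last first.
    apply: ler_wpM2l; last by lra.
    by apply: divr_ge0; last exact: ltW; lra.
  rewrite -subr_ge0 (_ : _ - _ = (12 * d - 16 * m) / (128 * m * d)).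
    apply: divr_ge0; first lra.
    by apply: mulr_ge0; last exact: ltW; apply: mulr_ge0; last exact: ltW.
  by field; rewrite mn gt_eqF.
exists (1 / (2 * K)).
have s0 : 0 <= 1 / (2 * K) by rewrite divr_ge0 // mulr_ge0 // ltW.
have s1 : 1 / (2 * K) <= 1 / 2 by rewrite ler_pdivrMr ?mulr_gt0 //; lra.
split; [exact: s0|lra|]; rewrite ge_min; apply/orP; right; rewrite E.
have -> : 7 / 8 - K * (1 / (2 * K)) = 3 / 8 by field.
apply: (@le_trans _ _ (1 / (2 * K) * (1 / 2) / m * (3 / 8))); last first.
  apply: ler_wpM2r; first by lra.
  apply: ler_wpM2r; first by rewrite invr_ge0 ltW.
  by apply: ler_wpM2l => //; lra.
have -> : 1 / (2 * K) * (1 / 2) / m * (3 / 8)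
   = (1 - 2 * alpha) ^+ 2 * (6 * m) / (1024 * n * alpha ^+ 2).
  by rewrite defK; field; rewrite mn nn kn an.
have C0 : 0 < 1024 * n * alpha ^+ 2.
  apply: mulr_gt0; last exact: exprn_gt0.
  by apply: mulr_gt0; first by rewrite ltr0n.
apply: ler_wpM2r; first by rewrite invr_ge0; apply: ltW.
have q0 : 0 <= (1 - 2 * alpha) ^+ 2 by apply: sqr_ge0.
have q1 : (1 - 2 * alpha) ^+ 2 <= 1 by rewrite expr_le1 //; lra.
rewrite (exprD _ 2 2) -mulrA ler_wpM2l //.
apply: le_trans (_ : 1 * d <= _); last by lra.
by rewrite ler_wpM2r // ltW.
Qed.

(** The supremum is at least the average over the hypercube, and the loss at
    least its part on the first coordinate of each pair, where the target is
    [(a + b) ^ 2] or [(a - b) ^ 2]. *)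
Lemma worst_risk_ge (R : realType) (m r n : nat) (alpha a b eta : R)
    (psi : 'I_(m + m + r) -> 'cV[R[i]]_(m + m + r))
    (W : 'I_n -> countType) (M : forall i, W i -> 'M[R[i]]_(m + m + r))
    (phat : {dffun forall i : 'I_n, W i} -> 'cV[R]_(m + m + r)) :
  (0 < m)%N -> 0 < alpha -> alpha < 1 / 2 -> orthonormal_basis psi ->
  (2 * m)%:R * (a ^+ 2 + b ^+ 2) = 1 -> 0 < eta ->
  locally_gentle alpha M ->
  ((4 * a ^+ 2 * b ^+ 2
    * (m%:R - 2 * m%:R * n%:R * eta
       - n%:R * (32 * b ^+ 2 * alpha ^+ 2 / (1 - 2 * alpha) ^+ 2)))%:E
   <= worst_risk psi M phat)%E.
Proof.
move=> m0 a0 a1 hpsi hab eta0 hM.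
pose g (tau : cube m) := cube_amplitude r a b tau.
pose x tau := \sum_k (g tau k 0)%:C%C *: psi k.
pose p i tau w := outcome_prob (M i) (ketbra (x tau)) w.
have p0 i tau w : 0 <= p i tau w.
  by have := tr_ketbra_effect_ge0 (M i) (x tau) w; rewrite lecE => /andP[].
have hF i : exists F : {fset W i},
    [/\ forall tau, \sum_(w : F) p i tau (val w) <= 1,
        forall tau, 1 - eta <= \sum_(w : F) p i tau (val w) &
        \sum_tau \sum_j \sum_(w : F)
          (Num.sqrt (p i tau (val w))
           - Num.sqrt (p i (flip tau j) (val w))) ^+ 2
        <= 32 * b ^+ 2 * alpha ^+ 2 / (1 - 2 * alpha) ^+ 2
           * #|cube m|%:R].
  by have [hmeas hgentle] := hM i; apply: cube_state_statistics.
pose F i : {fset W i} := projT1 (cid (hF i)).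
have FP i := projT2 (cid (hF i)).
pose T_ (i : 'I_n) : finType := F i.
pose emb (t : fprod T_) : {dffun forall i : 'I_n, W i} :=
  finfun (fun i => val (t i)).
have emb_inj : injective emb.
  move=> t u /ffunP htu; apply/fprodP => i; apply: val_inj.
  by have := htu i; rewrite !ffunE.
pose th (t : bool) : R := (a + (-1) ^+ t * b) ^+ 2.
pose est t (j : 'I_m) := phat (emb t) (lshift r (lshift m j)) 0.
pose L tau := \sum_(t : fprod T_)
  (\prod_i p i tau (val (t i))) * \sum_j (est t j - th (tau j)) ^+ 2.
have hL tau : ((L tau)%:E <= worst_risk psi M phat)%E.
  pose q : 'cV[R]_(m + m + r) := \col_k (complex.Re `|(g tau k 0)%:C%C| ^+ 2).
  apply: (@le_trans _ _ (expected_loss (tensor_measurement M) phat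
              (tensmxn (fun _ : 'I_n => ketbra (x tau))) q)); last first.
    apply: ereal_sup_ubound.
    exists (ketbra (x tau)), (fun k => (g tau k 0)%:C%C).
    split=> //; apply: pure_ketbra.
    by rewrite real_amplitude_norm // cube_amplitude_norm hab.
  apply: le_trans (esum_ge_inj _ emb_inj); rewrite lee_fin.
  apply: ler_sum => t _; rewrite outcome_prob_tensor.
  have -> : \prod_i outcome_prob (M i) (ketbra (x tau)) (emb t i)
      = \prod_i p i tau (val (t i)).
    by apply: eq_bigr => i _; rewrite /p /emb ffunE.
  apply: ler_wpM2l; first by apply: prodr_ge0.
  rewrite /sqnorm2 !big_split_ord /= -addrA.
  pose k0 (j : 'I_m) := lshift r (lshift m j).
  apply: (@le_trans _ _ (\sum_(j < m) (phat (emb t) - q) (k0 j) 0 ^+ 2)).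
    apply: ler_sum => j _.
    have [e1 _ _] := cube_amplitudeE r a b tau.
    suff -> : (phat (emb t) - q) (k0 j) 0 = est t j - th (tau j) by [].
    rewrite mxE [X in _ + X]mxE [q _ _]mxE /est /th; congr (_ - _).
    by rewrite normc_def /= expr0n addr0 sqr_sqrtr ?sqr_ge0 // -e1.
  by rewrite lerDl addr_ge0 // sumr_ge0 // => k _; apply: sqr_ge0.
have := @assouad_product R n m T_ (fun i tau w => p i tau (val w)) est th eta
  (32 * b ^+ 2 * alpha ^+ 2 / (1 - 2 * alpha) ^+ 2).
set B := _ - _ - _.
have -> : (th true - th false) ^+ 2 / 4 * B = 4 * a ^+ 2 * b ^+ 2 * B.
  by rewrite /th /=; field.
move=> hass.
have hsum : 4 * a ^+ 2 * b ^+ 2 * B * #|cube m|%:R <= \sum_tau L tau.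
  by apply: hass => [i tau w|i tau|i tau|i] //; have [] := FP i.
have [tau htau] : exists tau, 4 * a ^+ 2 * b ^+ 2 * B <= L tau.
  apply: contrapT => /forallNP hlt; move: hsum; rewrite leNgt => /negP; apply.
  rewrite mulrC -sum_const_card; apply: ltr_sum.
    by apply/hasP; exists [ffun=> true].
  by move=> tau _; rewrite ltNge; apply/negP; apply: hlt.
by apply: le_trans (hL tau); rewrite lee_fin.
Qed.

Theorem theorem12 (R : realType) (d n : nat) (alpha : R)
    (psi : 'I_d -> 'cV[R[i]]_d)
    (hd : (2 <= d)%N) (hn : (1 <= n)%N)
    (halpha0 : 0 < alpha) (halpha1 : alpha < 1 / 2)
    (hpsi : orthonormal_basis psi) :
  ((Num.min (1 / (8 * d%:R))
            ((1 - 2 * alpha) ^+ 4 * d%:R / (1024 * n%:R * alpha ^+ 2)))%:E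
   <= ereal_inf
        [set r : \bar R | exists (W : 'I_n -> countType)
             (M : forall i, W i -> 'M[R[i]]_d)
             (phat : {dffun forall i : 'I_n, W i} -> 'cV[R]_d),
           locally_gentle alpha M /\ r = worst_risk psi M phat])%E.
Proof.
(* The rate needs [2 m <= d <= 3 m]; the second bound is attained at [d = 3]. *)
pose m := d./2; pose r := nat_of_bool (odd d).
have dE : d = (m + m + r)%N by rewrite addnn addnC /m /r odd_double_half.
have m0 : (0 < m)%N by rewrite half_gt0.
have r1 : (r <= 1)%N by rewrite /r; case: (odd d).
clearbody m r; subst d.
have [||||||s [s0 s1 hs]] := @rate_arithmetic R m%:R n%:R (m + m + r)%:R alpha;
  rewrite ?ler1n //.
- by rewrite -natrM ler_nat mul2n -addnn leq_addr.
- rewrite -natrM ler_nat mulSn mul2n -addnn [leqRHS]addnC leq_add2l.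
  exact: leq_trans r1 m0.
apply: le_ereal_inf_tmp => _ [W [M [phat [hM ->]]]].
have mR : 0 < (2 * m)%:R :> R by rewrite ltr0n muln_gt0.
have A0 : 0 <= (1 - s) / (2 * m%:R) by rewrite divr_ge0 ?subr_ge0 // -natrM ltW.
have B0 : 0 <= s / (2 * m%:R) by rewrite divr_ge0 // -natrM ltW.
pose a := Num.sqrt ((1 - s) / (2 * m%:R)); pose b := Num.sqrt (s / (2 * m%:R)).
have n0 : 0 < n%:R :> R by rewrite ltr0n.
have hab : (2 * m)%:R * (a ^+ 2 + b ^+ 2) = 1.
  by rewrite !sqr_sqrtr // natrM; field; rewrite pnatr_eq0 -lt0n.
have eta0 : 0 < 1 / (16 * n%:R) :> R by rewrite divr_gt0 // mulr_gt0.
have := worst_risk_ge phat m0 halpha0 halpha1 hpsi hab eta0 hM.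
by apply: le_trans; rewrite lee_fin !sqr_sqrtr.
Qed.
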